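(* Let $\rho>0$ and let $\phi_1,\dots,\phi_m\in L^2(I)$ be linearly independent functions, where each $\phi_j:I\to\mathbb{R}$. Let $U_f:=\{f_a:=\sum_{j=1}^m a_j\phi_j \;:\; a=(a_1,\dots,a_m)\in\mathbb{R}^m\}$, equipped with the $L^2$ metric $\mathrm{dist}_2$. Let $\Sigma^{-1}$ be the $m\times m$ matrix with entries $[\Sigma^{-1}]_{j,l}=\int_I\phi_j(t)\phi_l(t)\,dt$ for $j,l\in\{1,\dots,m\}$. Then the mechanism that, on input $f_a\in U_f$, releases $f_{\tilde a}$, where $\tilde a=M(a):=a+\frac{1}{\sqrt{2\rho}}\Sigma^{1/2}Z$ and $Z\sim\mathcal{N}(0,I_{m\times m})$, satisfies $\rho$-CGP with respect to $\mathrm{dist}_2$.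
   Context: $I=I_1\times\cdots\times I_d$ with each $I_i\subseteq\mathbb{R}$ (measurable); $L^2(I)$ is the space of square-integrable functions on $I$ (functions equal almost everywhere are identified), and $\mathrm{dist}_2(f,g):=\left(\int_I (f(t)-g(t))^2\,dt\right)^{1/2}$. Because the $\phi_j$ are linearly independent, $a\mapsto f_a$ is a bijection $\mathbb{R}^m\to U_f$; measurable subsets of $U_f$ are the images of measurable subsets of $\mathbb{R}^m$ under it, and distributions on $U_f$ are identified with distributions on $\mathbb{R}^m$. $\Sigma$ denotes the inverse of the (positive definite) matrix $\Sigma^{-1}$, and $\Sigma^{1/2}$ its symmetric positive definite square root. $\mathcal{N}(0,I_{m\times m})$ is the standard Gaussian distribution on $\mathbb{R}^m$. For distributions $\mathcal{P},\mathcal{Q}$ with densities $p,q$ and $\alpha>1$, the Rényi divergence of order $\alpha$ is $D_\alpha(\mathcal{P}\|\mathcal{Q}):=\frac{1}{\alpha-1}\log\left(\int p(y)^\alpha q(y)^{1-\alpha}\,dy\right)$. A randomized mechanism $M:U\to V$ on a metric space $(U,\mathrm{dist})$, with $\mathcal{M}(x)$ denoting the distribution of $M(x)$, satisfies $\rho$-CGP (concentrated geo-privacy) if for all $x,x'\in U$ and all $\alpha>1$, $D_\alpha(\mathcal{M}(x)\|\mathcal{M}(x'))\le\alpha\rho\,\mathrm{dist}(x,x')^2$. *)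

(* Defs.v *)
From HB Require Import structures.
From mathcomp Require Import all_boot all_order all_algebra.
From mathcomp Require Import all_classical all_reals all_analysis.
From mathcomp Require Import measurable_realfun.
Set Implicit Arguments.
Unset Strict Implicit.
Unset Printing Implicit Defensive.
Import Order.TTheory GRing.Theory Num.Theory.
Import numFieldNormedType.Exports.

Local Open Scope classical_set_scope.
Local Open Scope ring_scope.

(* Image of the product measure mu \x nu under (x, t) |-> x :: t. *)
Section cons_measure.
Context d (T : measurableType d) (R : realType) (n : nat).
Variables (mu : {sigma_finite_measure set T -> \bar R})
  (nu : {sigma_finite_measure set (n.-tuple T) -> \bar R}).

Definition cons_pair (x : T * n.-tuple T) : n.+1.-tuple T :=
  [tuple of x.1 :: x.2].

Lemma measurable_cons_pair : measurable_fun [set: T * n.-tuple T] cons_pair.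
Proof. exact: measurable_cons. Qed.

Definition cons_measure : set (n.+1.-tuple T) -> \bar R :=
  pushforward (mu \x nu)%E cons_pair.

Let cons_measure0 : cons_measure set0 = 0%E.
Proof. by rewrite /cons_measure /pushforward preimage_set0 measure0. Qed.

Let cons_measure_ge0 A : (0 <= cons_measure A)%E.
Proof. exact: (measure_ge0 (mu \x nu)%E). Qed.

Let cons_measure_sigma_additive : semi_sigma_additive cons_measure.
Proof.
move=> F mF tF mUF; rewrite /cons_measure.
pose p := measure_function_pushforward__canonical__measure_function_Measure
  (mu \x nu)%E measurable_cons_pair.
exact: (@measure_semi_sigma_additive _ _ _ p F mF tF mUF).
Qed.

HB.instance Definition _ := isMeasure.Build _ _ _ cons_measure
  cons_measure0 cons_measure_ge0 cons_measure_sigma_additive.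

Let cons_measure_sigma_finite : sigma_finite setT cons_measure.
Proof.
have /sigma_finiteP[F [TF ndF Foo]] := sigma_finiteT mu.
have /sigma_finiteP[G [TG ndG Goo]] := sigma_finiteT nu.
pose g (t : n.+1.-tuple T) := (thead t, [tuple of behead t]).
have gK : cancel cons_pair g.
  by move=> [x t]; rewrite /g /cons_pair theadE; congr pair; apply: val_inj.
have mg : measurable_fun setT g.
  apply/measurable_fun_pairP; split => /=.
    exact: measurable_tnth.
  exact: measurable_behead.
exists (fun k => g @^-1` (F k `*` G k)).
  rewrite predeqE => t; split => // _.
  have [i _ Fi] : (\bigcup_i F i) (g t).1 by rewrite -TF.
  have [j _ Gj] : (\bigcup_j G j) (g t).2 by rewrite -TG.
  exists (maxn i j) => //; split.
  - by move: Fi; apply/subsetPset/ndF/leq_maxl.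
  - by move: Gj; apply/subsetPset/ndG/leq_maxr.
move=> k; have [mF Fk] := Foo k; have [mG Gk] := Goo k; split.
  by rewrite -[X in measurable X]setTI; apply: mg => //; exact: measurableX.
rewrite /cons_measure /pushforward -comp_preimage.
rewrite (_ : g \o cons_pair = id); last by apply/funext => x; exact: gK.
by rewrite preimage_id product_measure1E// lte_mul_pinfty// ge0_fin_numE.
Qed.

HB.instance Definition _ := Measure_isSigmaFinite.Build _ _ _ cons_measure
  cons_measure_sigma_finite.

End cons_measure.

(* n-fold product measure; on 0-tuples it is the Dirac mass. *)
Fixpoint tuple_measure d (T : measurableType d) (R : realType)
    (mu : {sigma_finite_measure set T -> \bar R}) (n : nat) :
    {sigma_finite_measure set (n.-tuple T) -> \bar R} :=
  if n is n'.+1 then cons_measure mu (tuple_measure mu n')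
  else dirac [tuple].


Definition box T n (A : 'I_n -> set T) : set (n.-tuple T) :=
  [set t | forall i, A i (tnth t i)].

Lemma measurable_box_prod d (T : measurableType d) n (A : 'I_n -> set T) :
  (forall i, measurable (A i)) -> measurable (box A).
Proof.
move=> mA.
rewrite (_ : box A = \bigcap_(i in [set: 'I_n]) ((@tnth n T)^~ i @^-1` A i)).
  apply: fin_bigcap_measurable => // i _.
  by rewrite -[X in measurable X]setTI; exact: measurable_tnth.
by apply/seteqP; split => [t At i _|t At i]; exact: At.
Qed.

Lemma tuple_measure_box d (T : measurableType d) (R : realType)
    (mu : {sigma_finite_measure set T -> \bar R}) n (A : 'I_n -> set T) :
  (forall i, measurable (A i)) ->
  tuple_measure mu n (box A) = (\prod_(i < n) mu (A i))%E.
Proof.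
elim: n A => [|n ih] A mA /=.
  by rewrite big_ord0 /dirac /= indicE mem_set // => -[].
rewrite big_ord_recl -ih//.
rewrite /cons_measure /pushforward.
rewrite (_ : _ @^-1` _ = A ord0 `*` box (fun i => A (lift ord0 i))).
  by rewrite product_measure1E//; exact: measurable_box_prod.
apply/seteqP; split => -[x t] /=.
  move=> At; split; first by have := At ord0.
  by move=> i; have := At (lift ord0 i); rewrite tnthS.
by move=> [/= Ax At] i; case: (unliftP ord0 i) => [j|] ->; rewrite ?tnthS.
Qed.

Notation Rvec R n := (n.-tuple (measurableTypeR R)).

Definition lebesgue_vec (R : realType) (n : nat) :
    {sigma_finite_measure set (Rvec R n) -> \bar R} :=
  tuple_measure (@lebesgue_measure R) n.

(* n-dimensional Lebesgue measure on the Lebesgue (not only Borel) measurable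
   sets. *)
Definition completed_lebesgue_vec (R : realType) (n : nat) :=
  @completed_measure_extension _ _ _ (lebesgue_vec R n).
HB.instance Definition _ (R : realType) n :=
  Measure.on (@completed_lebesgue_vec R n).

(* The sigma-algebra on which [completed_lebesgue_measure] is defined. *)
Definition lebesgue_measurable (R : realType) : set (set R) :=
  (@wlength R idfun)^*%mu.-cara.-measurable.

Lemma lebesgue_measurable_box (R : realType) n (A : 'I_n -> set R) :
  (forall i, lebesgue_measurable (A i)) ->
  (lebesgue_vec R n)^*%mu.-cara.-measurable (box A).
Proof.
move=> mA; pose cara := caratheodory_type (lebesgue_vec R n)^*%mu.
rewrite (_ : box A = \bigcap_(i in [set: 'I_n]) ((@tnth n R)^~ i @^-1` A i));
  last by apply/seteqP; split => [t At i _|t At i]; exact: At.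
apply: (@fin_bigcap_measurable _ cara) => // i _; move: (mA i).
rewrite /lebesgue_measurable -completed_caratheodory_measurable.
rewrite g_sigma_completed_algebra_genE => -[/= X mX] [N [B [mB B0 NB]]] <-.
have mtnth (Y : set (measurableTypeR R)) : measurable Y ->
    measurable ((fun t : Rvec R n => tnth t i) @^-1` Y).
  by move=> mY; rewrite -[X in measurable X]setTI; exact: measurable_tnth.
rewrite preimage_setU; apply: (@measurableU _ cara).
  exact: (@caratheodory_measurable_mu_ext _ R _ (lebesgue_vec R n) _ (mtnth _ mX)).
apply: (@measure_is_complete_caratheodory _ _ (lebesgue_vec R n)^*%mu).
exists ((fun t : Rvec R n => tnth t i) @^-1` B); split.
- exact: (@caratheodory_measurable_mu_ext _ R _ (lebesgue_vec R n) _ (mtnth _ mB)).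
- apply: (etrans (@measurable_mu_extE _ R _ (lebesgue_vec R n) _ (mtnth _ mB))).
  pose C j : set (measurableTypeR R) := if j == i then B else setT.
  rewrite (_ : _ @^-1` _ = box C); last first.
    apply/seteqP; split => t /=; last by move=> /(_ i); rewrite /C eqxx.
    by move=> Bt j; rewrite /C; case: eqP => // ->.
  rewrite [LHS](_ : _ = tuple_measure (@lebesgue_measure R) n (box C))//.
  rewrite tuple_measure_box; last by move=> j; rewrite /C; case: ifP.
  by rewrite (bigD1 i)//= /C eqxx [X in (X * _)%E]B0 mul0e.
- by move=> t /= /NB.
Qed.

(* Lebesgue measure restricted to A_1 x ... x A_n. Functions on this box are
   represented by functions on the whole space: measurability is unaffected
   (extend by 0), and integrals and almost-everywhere statements with respect
   to this measure do not see values taken outside the box. *)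
Definition lebesgue_on (R : realType) n (A : 'I_n -> set R)
    (mA : forall i, lebesgue_measurable (A i)) :=
  mrestr (@completed_lebesgue_vec R n) (lebesgue_measurable_box mA).
HB.instance Definition _ (R : realType) n (A : 'I_n -> set R)
    (mA : forall i, lebesgue_measurable (A i)) := Measure.on (lebesgue_on mA).

(* Law of n independent N(0, 1) coordinates. *)
Definition std_gaussian (R : realType) (n : nat) :
    {sigma_finite_measure set (Rvec R n) -> \bar R} :=
  tuple_measure (normal_prob (0 : R) 1) n.


Section L2.
Context d (T : measurableType d) (R : realType).
Variable mu : {measure set T -> \bar R}.
Local Notation L2fun := (LfunType mu (lee1n 2)).
Local Open Scope quotient_scope.

(* Same function; only the codomain's (equal) sigma-algebra changes, as
   [LspaceType] is built on [measurableTypeR R]. *)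
Definition L2_mfun (f : L2fun) : {mfun T >-> measurableTypeR R} :=
  HB.pack_for {mfun T >-> measurableTypeR R} (f : T -> measurableTypeR R)
    (isMeasurableFun.Build _ _ T (measurableTypeR R) f (@measurable_funPT _ _ _ _ f)).

Definition L2_pi (f : L2fun) : {mfun_ mu, T >-> measurableTypeR R} :=
  \pi_({mfun_ mu, T >-> measurableTypeR R}) (L2_mfun f).

Lemma L2_piE (f : L2fun) : (L2_pi f : T -> R) = f %[ae mu].
Proof. by have /eqmodP/asboolP := reprK (L2_pi f). Qed.

Lemma finite_norm_L2_pi (f : L2fun) : finite_norm mu 2%:R%:E (L2_pi f).
Proof.
have := Lfunction_finite (lee1n 2) f; rewrite /finite_norm unlock.
have -> : (\int[mu]_x `|(EFin \o L2_pi f) x| `^ 2 =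
          \int[mu]_x `|(EFin \o f) x| `^ 2)%E.
  have mpow (h : T -> R) : measurable_fun [set: T] h ->
      measurable_fun [set: T] (fun x => (`|(EFin \o h) x| `^ 2)%E).
    move=> mh; have mEh : measurable_fun setT (EFin \o h) by exact/measurable_EFinP.
    exact: (measurableT_comp (measurable_poweR 2)
      (measurableT_comp (@abse_measurable R setT) mEh)).
  apply: ae_eq_integral => //.
  - exact/mpow/(@measurable_funPT _ _ _ _ (repr (L2_pi f))).
  - exact: mpow.
  - by apply: filterS (L2_piE f) => x /= fx _; rewrite fx.
by [].
Qed.

(* Class in L^2 of a square-integrable function. *)
Definition L2_class (f : L2fun) : LspaceType2 mu :=
  HB.pack_for (LspaceType2 mu) (L2_pi f)
   (isFinLebesgue.Build _ T R mu _ (lee1n 2) _ (finite_norm_L2_pi f)).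

Definition dist2 (u v : LspaceType2 mu) : R :=
  Num.sqrt (\int[mu]_t (((u t : R) - v t) ^+ 2))%R.

Section span.
Variables (m : nat) (phi : 'I_m -> L2fun).

Definition lincomb (a : Rvec R m) : L2fun := \sum_j (tnth a j : R) *: phi j.

Definition lin_indep : Prop :=
  forall a : Rvec R m, (lincomb a : T -> R) = cst 0 %[ae mu] ->
  forall j, tnth a j = 0.

Definition gram : 'M[R]_m := \matrix_(j, l) (\int[mu]_t (phi j t * phi l t))%R.

Definition Uf : Type := {u : LspaceType2 mu | exists a, u = L2_class (lincomb a)}.

Definition f_ (a : Rvec R m) : Uf :=
  exist _ (L2_class (lincomb a)) (ex_intro _ a erefl).

(* Inverse of [f_] when [phi] is linearly independent. *)
Definition coef (u : Uf) : Rvec R m := sval (cid (svalP u)).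

HB.instance Definition _ := gen_eqMixin Uf.
HB.instance Definition _ := gen_choiceMixin Uf.
HB.instance Definition _ := isPointed.Build Uf (f_ [tuple of nseq m 0]).

(* Images of the measurable sets of coefficient vectors. When [phi] is linearly
   independent [f_] is a bijection and this is already a sigma-algebra, so the
   generated one below adds no set. *)
Definition Uf_images : set (set Uf) := [set f_ @` B | B in measurable].

Definition Uf_measurableType := g_sigma_algebraType Uf_images.

(* Reference measure for densities on Uf: Lebesgue measure on R^m carried over
   by the identification [f_]. *)
Definition Uf_lebesgue : set Uf_measurableType -> \bar R :=
  pushforward (lebesgue_vec R m) (f_ : Rvec R m -> Uf_measurableType).

End span.

End L2.
Arguments Uf_lebesgue {d T R mu m} phi.

Section cgp.
Context (R : realType) d (V : measurableType d).

Definition has_density (nu P : set V -> \bar R) (p : V -> R) : Prop :=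
  [/\ measurable_fun [set: V] p, (forall y, 0 <= p y) &
      forall A, measurable A -> P A = (\int[nu]_(y in A) (p y)%:E)%E].

(* p^alpha q^(1-alpha) for alpha > 1, with the usual values where q vanishes:
   0 if p does too, +oo otherwise ([powR] would return 0 in both cases). *)
Definition renyi_integrand (alpha : R) (p q : V -> R) (y : V) : \bar R :=
  if q y == 0 then if p y == 0 then 0%E else +oo%E
  else (p y `^ alpha * q y `^ (1 - alpha))%:E.

Definition renyi_divergence (nu : set V -> \bar R) (alpha : R) (p q : V -> R) :
    \bar R :=
  (((alpha - 1)^-1)%:E * lne (\int[nu]_y renyi_integrand alpha p q y))%E.

(* nu is the reference measure of the densities. Each M x has to be a random
   variable whose law has a density; the bound is required for all versions of
   the densities. *)
Definition CGP (U : Type) (dist : U -> U -> R) (nu : set V -> \bar R)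
    dO (Omega : measurableType dO) (P : probability Omega R)
    (M : U -> Omega -> V) (rho : R) : Prop :=
  [/\ forall x, measurable_fun [set: Omega] (M x),
      forall x, exists p, has_density nu (pushforward P (M x)) p &
      forall x x' p q (alpha : R), 1 < alpha ->
        has_density nu (pushforward P (M x)) p ->
        has_density nu (pushforward P (M x')) q ->
        (renyi_divergence nu alpha p q <= (alpha * rho * dist x x' ^+ 2)%:E)%E].

End cgp.

Definition spd (R : realType) m (A : 'M[R]_m) : Prop :=
  A^T = A /\ forall v : 'cV[R]_m, v != 0 -> 0 < (v^T *m A *m v) 0 0.

Definition is_spd_sqrt (R : realType) m (A S : 'M[R]_m) : Prop :=
  spd S /\ S *m S = A.

Definition perturb (R : realType) m (rho : R) (S : 'M[R]_m) (a z : Rvec R m) :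
    Rvec R m :=
  [tuple tnth a j + (Num.sqrt (2 * rho))^-1 * (S *m \col_l tnth z l) j 0 | j < m].

Definition gaussian_mechanism (R : realType) d (T : measurableType d)
    (mu : {measure set T -> \bar R}) m (phi : 'I_m -> LfunType mu (lee1n 2))
    (rho : R) (S : 'M[R]_m) dO (Omega : measurableType dO)
    (Z : Omega -> Rvec R m) (u : Uf phi) (w : Omega) : Uf_measurableType phi :=
  f_ phi (perturb rho S (coef u) (Z w)).

(* Main.v *)
(* The mechanism run on a and on b is the same affine bijection of R^m applied
   to Z + h and to Z, where h = sqrt (2 rho) Sigma^(-1/2) (a - b). By the
   Cameron-Martin formula the law on a has density exp(<h, z> - |h|^2 / 2) with
   respect to the law on b, z being the noise that produces the output, so the
   Renyi divergence is alpha |h|^2 / 2, and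
   |h|^2 = 2 rho (a - b)^T Sigma^-1 (a - b) = 2 rho dist2 (f_a, f_b)^2.

   That the laws have densities follows from the same quasi-invariance, with no
   determinant: if f is affine and onto and A is Lebesgue-null, then, y and z
   being independent Gaussian vectors, Fubini gives f z + y \notin A almost
   surely, hence for some fixed y; writing f z + y = f (z + h) removes y. *)
Require Import Defs.
From HB Require Import structures.
From mathcomp Require Import all_boot all_order all_algebra.
From mathcomp Require Import all_classical all_reals all_analysis.
From mathcomp Require Import measurable_realfun.
From mathcomp Require Import ring.
Set Implicit Arguments.
Unset Strict Implicit.
Unset Printing Implicit Defensive.
Import Order.TTheory GRing.Theory Num.Theory.
Import numFieldNormedType.Exports.

Local Open Scope classical_set_scope.
Local Open Scope ring_scope.

(** * Integration against a density, and translations of the line *)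

(** Change of variables holds for the Radon-Nikodym derivative of [Q], and [q] agrees with it
    [nu]-almost everywhere because both have the same integral over every measurable set. *)
Lemma ge0_integral_density d (T : measurableType d) (R : realType)
    (nu : {sigma_finite_measure set T -> \bar R})
    (Q : {finite_measure set T -> \bar R}) (q : T -> R) (D : set T)
    (f : T -> \bar R) :
  has_density nu Q q -> measurable D -> measurable_fun D f ->
  (forall x, 0 <= f x)%E ->
  (\int[Q]_(x in D) f x = \int[nu]_(x in D) (f x * (q x)%:E))%E.
Proof.
move=> [mq q0 Qq] mD mf f0.
have Qnu : Q `<< nu.
  apply/null_content_dominatesP => A mA A0; rewrite Qq//.
  apply: null_set_integral => //.
  exact/measurable_EFinP/measurable_funTS.
rewrite -(Radon_Nikodym_SigmaFinite.change_of_variables Qnu)//.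
set g := Radon_Nikodym_SigmaFinite.f Q nu.
have ig : nu.-integrable setT g := Radon_Nikodym_SigmaFinite.f_integrable Qnu.
have mg := measurable_int _ ig.
apply: ae_eq_integral => //.
- by apply: emeasurable_funM => //; exact: measurable_funTS.
- apply: emeasurable_funM => //.
  exact/measurable_EFinP/measurable_funTS.
have : ae_eq nu setT g (EFin \o q).
  apply: integral_ae_eq => //; first exact/measurable_EFinP.
  move=> E _ mE; rewrite -Radon_Nikodym_SigmaFinite.f_integral//.
  exact: Qq.
by apply: filterS => x /(_ I) /= -> _.
Qed.

(** Lebesgue measure and its image under a translation agree on half-open intervals, hence on all
    measurable sets. *)
Lemma lebesgue_measure_shift (R : realType) (h : R) (f : R -> \bar R) :
  measurable_fun setT f -> (forall x, 0 <= f x)%E ->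
  (\int[@lebesgue_measure R]_x f ((x : R) + h)%R = \int[@lebesgue_measure R]_x f x)%E.
Proof.
move=> mf f0.
pose s (x : measurableTypeR R) : measurableTypeR R := (x : R) + h.
have mh : measurable_fun setT s.
  by apply: (@measurable_funD _ (measurableTypeR R) R setT id (cst h)).
pose mu := measure_function_pushforward__canonical__measure_function_Measure
  (@lebesgue_measure R) mh.
have muE A : measurable A -> lebesgue_measure A = mu A.
  apply: lebesgue_measure_unique => X [[a b] _ <-].
  rewrite /mu/= /pushforward lebesgue_measure_itv/=.
  rewrite (_ : _ @^-1` _ = `]a - h, b - h]%classic).
    by rewrite lebesgue_measure_itv/= !lte_fin ltrD2r -!EFinD opprD addrACA subrr addr0.
  by apply/seteqP; split => x /=; rewrite !in_itv/= ltrBlDr lerBrDr.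
transitivity (\int[mu]_x f x)%E; last first.
  by apply: eq_measure_integral => A mA _; exact/esym/muE.
by rewrite /mu ge0_integral_pushforward.
Qed.

(** Translating the Lebesgue integral by -h moves the shift onto the Gaussian density, where -(x -
    h)^2 / 2 = -x^2 / 2 + h x - h^2 / 2. *)
Lemma normal_prob_cameron_martin (R : realType) (h : R) (f : R -> \bar R) :
  measurable_fun setT f -> (forall x, 0 <= f x)%E ->
  (\int[@normal_prob R 0 1]_x f ((x : R) + h)%R =
   \int[@normal_prob R 0 1]_x (f x * (expR (h * (x : R) - h ^+ 2 / 2))%:E))%E.
Proof.
move=> mf f0.
have dens : has_density (@lebesgue_measure R) (normal_prob 0 1)
    (normal_pdf (0 : R) 1).
  by split => //; [exact: measurable_normal_pdf|exact: normal_pdf_ge0].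
have mw : measurable_fun setT (fun x : R => (expR (h * x - h ^+ 2 / 2))%:E).
  apply/measurable_EFinP; apply: measurableT_comp => //.
  by apply: measurable_funB => //; exact: measurable_funM.
have mfh : measurable_fun setT (fun x : R => f (x + h)).
  by apply: measurableT_comp => //; exact: measurable_funD.
rewrite !(ge0_integral_density dens)//; last 2 first.
- exact: emeasurable_funM.
- by move=> x; rewrite mule_ge0// lee_fin expR_ge0.
rewrite -[LHS](lebesgue_measure_shift (-h)); last 2 first.
- apply: emeasurable_funM => //.
  by apply/measurable_EFinP; exact: measurable_normal_pdf.
- by move=> x; rewrite mule_ge0// lee_fin normal_pdf_ge0.
apply: eq_integral => x _; rewrite subrK -muleA -EFinM; congr (_ * _%:E)%E.
rewrite normal_pdfE ?oner_neq0// mulrCA; congr (_ * _).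
rewrite /normal_fun -expRD; congr expR.
by rewrite !subr0 expr1n; field.
Qed.

(** * Iterated integrals and null sets for tuple measures *)

Lemma ge0_integral_cons_measure d (T : measurableType d) (R : realType) n
    (mu : {sigma_finite_measure set T -> \bar R})
    (nu : {sigma_finite_measure set (n.-tuple T) -> \bar R})
    (f : n.+1.-tuple T -> \bar R) :
  measurable_fun setT f -> (forall x, 0 <= f x)%E ->
  (\int[cons_measure mu nu]_t f t =
   \int[mu]_x \int[nu]_t f [tuple of x :: t])%E.
Proof.
move=> mf f0; rewrite [LHS]ge0_integral_pushforward//; last first.
  exact: measurable_cons_pair.
rewrite preimage_setT fubini_tonelli1//.
- by apply: measurableT_comp mf _; exact: measurable_cons_pair.
- by move=> x; exact: f0.
Qed.

(** Induction on [n]: [nu]-almost every section of a null set is null, such a section is null for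
    the [mu] tuple measure by induction, and the exceptional set of first coordinates is also
    [mu]-null. *)
Lemma null_dominates_tuple_measure d (T : measurableType d) (R : realType)
    (mu nu : {sigma_finite_measure set T -> \bar R}) n :
  mu `<< nu -> tuple_measure mu n `<< tuple_measure nu n.
Proof.
move=> munu; elim: n => [|n ih] //=.
have /null_content_dominatesP munu' := munu.
have /null_content_dominatesP ih' := ih.
apply/null_content_dominatesP => A mA.
rewrite /= /cons_measure /pushforward /=.
set B := _ @^-1` A.
have mB : measurable B.
  by rewrite -[B]setTI; exact: measurable_cons_pair.
rewrite /product_measure1 => B0.
have ae_nu : {ae nu, forall x, tuple_measure nu n (xsection B x) = 0%E}.
  have := (ae_eq_integral_abs nu measurableT
    (measurable_fun_xsection (tuple_measure nu n) mB)).1.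
  under eq_integral do rewrite /= gee0_abs//.
  move=> /(_ B0); apply: filterS => x /(_ I) /= <- //.
have : ae_eq mu setT (tuple_measure mu n \o xsection B) (cst 0%E).
  have [N [mN N0 NB]] := ae_nu.
  exists N; split => //; first exact: munu'.
  apply: subset_trans NB => x /= /not_implyP[_] + nB; apply.
  by apply: ih' => //; exact: measurable_xsection.
move/(ae_eq_integral _ _ measurableT (measurable_fun_xsection _ mB)) => ->//.
by rewrite integral0.
Qed.

(** * The Cameron-Martin formula for Gaussian vectors *)

Definition shift_tuple (R : realType) n (h t : Rvec R n) : Rvec R n :=
  [tuple tnth t i + tnth h i | i < n].

Definition dot_tuple (R : realType) n (h t : Rvec R n) : R :=
  \sum_(i < n) tnth h i * tnth t i.

Lemma measurable_tnthR (R : realType) n (i : 'I_n) :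
  measurable_fun [set: Rvec R n] (fun t : Rvec R n => tnth t i : R).
Proof. exact: (@measurable_tnth _ (measurableTypeR R)). Qed.

Lemma measurable_dot_tuple (R : realType) n (h : Rvec R n) :
  measurable_fun setT (dot_tuple h).
Proof.
apply: measurable_sum => i; apply: measurable_funM => //.
exact: measurable_tnthR.
Qed.

Lemma measurable_shift_tuple (R : realType) n (h : Rvec R n) :
  measurable_fun setT (shift_tuple h).
Proof.
apply/measurable_fun_tnthP => i.
rewrite (_ : _ \o _ = fun t => (tnth t i : R) + tnth h i).
  by apply: (@measurable_funD _ _ R) => //; exact: measurable_tnthR.
by apply/funext => t /=; rewrite tnth_mktuple.
Qed.

(* Density of the law of Z + h with respect to that of Z, Z standard Gaussian. *)
Definition cameron_martin (R : realType) n (h t : Rvec R n) : R :=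
  expR (dot_tuple h t - dot_tuple h h / 2).

Lemma measurable_cameron_martin (R : realType) n (h : Rvec R n) :
  measurable_fun setT (cameron_martin h).
Proof.
apply: measurableT_comp => //; apply: measurable_funB => //.
exact: measurable_dot_tuple.
Qed.

Lemma ge0_integral_std_gaussianS (R : realType) n (f : Rvec R n.+1 -> \bar R) :
  measurable_fun setT f -> (forall x, 0 <= f x)%E ->
  (\int[std_gaussian R n.+1]_t f t =
   \int[@normal_prob R 0 1]_x \int[std_gaussian R n]_t f [tuple of x :: t])%E.
Proof. exact: ge0_integral_cons_measure. Qed.

(** Induction on [n] through iterated integrals: the dot product splits into head and tail, so the
    density is the product of the one-dimensional one and the one of the tail. *)
Lemma std_gaussian_cameron_martin (R : realType) n (h : Rvec R n)
    (f : Rvec R n -> \bar R) :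
  measurable_fun setT f -> (forall x, 0 <= f x)%E ->
  (\int[std_gaussian R n]_t f (shift_tuple h t) =
   \int[std_gaussian R n]_t (f t * (cameron_martin h t)%:E))%E.
Proof.
elim: n h f => [|n ih] h f mf f0.
  apply: eq_integral => t _; rewrite (tuple0 (shift_tuple h t)) (tuple0 t).
  by rewrite /cameron_martin /dot_tuple !big_ord0 mul0r subrr expR0 mule1.
rewrite !ge0_integral_std_gaussianS//; last 3 first.
- apply: emeasurable_funM => //.
  by apply/measurable_EFinP; exact: measurable_cameron_martin.
- by move=> x; rewrite mule_ge0// lee_fin expR_ge0.
- by apply: measurableT_comp => //; exact: measurable_shift_tuple.
have [h0 [h' ->]] : exists h0 (h' : Rvec R n), h = [tuple of h0 :: h'].
  by case/tupleP: h => h0 h'; exists h0, h'.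
have shiftE x (t : Rvec R n) : shift_tuple [tuple of h0 :: h'] [tuple of x :: t] =
    [tuple of ((x : R) + (h0 : R) : measurableTypeR R) :: shift_tuple h' t].
  apply: eq_from_tnth => i; rewrite tnth_mktuple.
  by case: (unliftP ord0 i) => [j|] ->; rewrite ?tnthS// tnth_mktuple.
have cmE x (t : Rvec R n) : cameron_martin [tuple of h0 :: h'] [tuple of x :: t] =
    expR (h0 * x - h0 ^+ 2 / 2) * cameron_martin h' t.
  rewrite /cameron_martin -expRD; congr expR.
  rewrite /dot_tuple !big_ord_recl !tnth0.
  under eq_bigr do rewrite !tnthS.
  under [X in - ((_ + X) / _)]eq_bigr do rewrite !tnthS.
  by field.
have mcons x : measurable_fun setT (fun t : Rvec R n => f [tuple of x :: t]).
  apply: measurableT_comp => //.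
  exact: (@measurable_cons _ _ _ (measurableTypeR R)).
pose F x : \bar R :=
  (\int[std_gaussian R n]_t (f [tuple of x :: t] * (cameron_martin h' t)%:E))%E.
have mF : measurable_fun setT F.
  apply: (@measurable_fun_fubini_tonelli_F _ _ (measurableTypeR R) (Rvec R n) R
    (std_gaussian R n) (fun z => f (cons_pair z) * (cameron_martin h' z.2)%:E)%E).
    apply: emeasurable_funM.
      by apply: measurableT_comp mf _; exact: measurable_cons_pair.
    apply/measurable_EFinP; apply: measurableT_comp => //.
    exact: measurable_cameron_martin.
  by move=> z; rewrite mule_ge0// lee_fin expR_ge0.
have F0 x : (0 <= F x)%E.
  by apply: integral_ge0 => t _; rewrite mule_ge0// lee_fin expR_ge0.
(* For each fixed head the tail shift is removed first; the head shift then acts on [F] alone. *)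
transitivity (\int[@normal_prob R 0 1]_x F ((x : R) + h0)%R)%E.
  apply: eq_integral => x _; under eq_integral do rewrite shiftE.
  by rewrite (ih h' (fun t => f [tuple of _ :: t])).
rewrite normal_prob_cameron_martin//; apply: eq_integral => x _.
under [RHS]eq_integral do rewrite cmE EFinM muleCA.
rewrite ge0_integralZl//; first by rewrite muleC.
- apply: emeasurable_funM => //.
  by apply/measurable_EFinP; exact: measurable_cameron_martin.
- by move=> t _; rewrite mule_ge0// lee_fin expR_ge0.
Qed.

(** * The Renyi integral in terms of a relative density *)

(** Both sides integrate to [P A] over every measurable [A], and [p] is integrable since [P] is
    finite. *)
Lemma density_unique d (T : measurableType d) (R : realType)
    (nu : {sigma_finite_measure set T -> \bar R})
    (P Q : {finite_measure set T -> \bar R}) (p q r : T -> R) :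
  measurable_fun setT r -> (forall y, 0 <= r y) ->
  (forall A, measurable A -> P A = (\int[Q]_(y in A) (r y)%:E)%E) ->
  has_density nu P p -> has_density nu Q q ->
  {ae nu, forall y, p y = r y * q y}.
Proof.
move=> mr r0 Pr [mp p0 Pp] dq; have [mq q0 _] := dq.
suff : ae_eq nu setT (EFin \o p) (fun y => (r y * q y)%:E).
  by apply: filterS => y /(_ I) /= [].
apply: integral_ae_eq => //.
- apply/integrableP; split; first exact/measurable_EFinP.
  under eq_integral do rewrite /= ger0_norm//.
  rewrite -Pp//; exact: fin_num_fun_lty.
- by apply/measurable_EFinP; exact: measurable_funM.
- move=> A _ mA; rewrite -Pp// Pr// (ge0_integral_density dq)//.
  exact/measurable_EFinP/measurable_funTS.
Qed.

Lemma measurable_renyi_integrand d (T : measurableType d) (R : realType)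
    (alpha : R) (p q : T -> R) :
  measurable_fun setT p -> measurable_fun setT q ->
  measurable_fun setT (renyi_integrand alpha p q).
Proof.
move=> mp mq; apply: measurable_fun_ifT.
- exact: measurable_fun_eqr.
- by apply: measurable_fun_ifT => //; exact: measurable_fun_eqr.
- apply/measurable_EFinP; apply: measurable_funM.
    exact: (measurableT_comp (measurable_powR _)).
  exact: (measurableT_comp (measurable_powR _)).
Qed.

Lemma renyi_integrand_ge0 d (T : measurableType d) (R : realType) (alpha : R) (p q : T -> R) y :
  (0 <= renyi_integrand alpha p q y)%E.
Proof.
rewrite /renyi_integrand; case: eqP => _; first by case: eqP.
by rewrite lee_fin mulr_ge0 ?powR_ge0.
Qed.

(** Where [q] vanishes so does [p], hence the value +oo never occurs; elsewhere (r q)^alpha q^(1 -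
    alpha) = r^alpha q. *)
Lemma renyi_integrand_density d (T : measurableType d) (R : realType) (alpha : R)
    (p q r : T -> R) y :
  alpha != 0 -> 0 <= r y -> 0 <= q y -> p y = r y * q y ->
  renyi_integrand alpha p q y = (r y `^ alpha * q y)%:E.
Proof.
move=> alpha0 r0 q0 pE; rewrite /renyi_integrand pE.
have [->|qn0] := eqVneq (q y) 0; first by rewrite mulr0 eqxx mulr0.
rewrite powRM// -mulrA -powRD; last by rewrite qn0 implybT.
by rewrite addrC subrK powRr1.
Qed.

(** This eliminates the reference measure and the choice of versions of [p] and [q]: only the
    density [r] of [P] relative to [Q] remains. *)
Lemma integral_renyi_integrand d (T : measurableType d) (R : realType)
    (nu : {sigma_finite_measure set T -> \bar R})
    (P Q : {finite_measure set T -> \bar R}) (p q r : T -> R) (alpha : R) :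
  alpha != 0 -> measurable_fun setT r -> (forall y, 0 <= r y) ->
  (forall A, measurable A -> P A = (\int[Q]_(y in A) (r y)%:E)%E) ->
  has_density nu P p -> has_density nu Q q ->
  (\int[nu]_y renyi_integrand alpha p q y = \int[Q]_y (r y `^ alpha)%:E)%E.
Proof.
move=> alpha0 mr r0 Pr dp dq; have [[mp p0 _] [mq q0 _]] := (dp, dq).
have mra : measurable_fun setT (fun y => r y `^ alpha).
  exact: (measurableT_comp (measurable_powR _)).
rewrite (ge0_integral_density dq)//; last 2 first.
- exact/measurable_EFinP.
- by move=> y; rewrite lee_fin powR_ge0.
apply: ae_eq_integral => //.
- exact: measurable_renyi_integrand.
- by apply: emeasurable_funM; exact/measurable_EFinP.
have := density_unique mr r0 Pr dp dq; apply: filterS => y pE _.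
by rewrite (renyi_integrand_density alpha0 _ _ pE)// EFinM.
Qed.

(** * Moments of the Cameron-Martin density *)

Lemma std_gaussian_setT (R : realType) n : std_gaussian R n setT = 1%E.
Proof.
have -> : [set: Rvec R n] = box (fun=> setT) by apply/seteqP.
rewrite tuple_measure_box// big1// => i _.
exact: probability_setT.
Qed.

Lemma integral_cameron_martin (R : realType) n (h : Rvec R n) :
  (\int[std_gaussian R n]_t (cameron_martin h t)%:E = 1)%E.
Proof.
under eq_integral do rewrite -[_%:E]mul1e.
rewrite -(std_gaussian_cameron_martin h (f := cst 1%E))//=.
by rewrite integral_cst// mul1e; exact: std_gaussian_setT.
Qed.

(** Up to a constant factor, the power alpha of the density for h is the density for alpha h, whose
    integral is 1; the factor makes up for |h|^2 being multiplied by alpha^2 instead of alpha. *)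
Lemma integral_cameron_martin_powR (R : realType) n (h : Rvec R n) (alpha : R) :
  (\int[std_gaussian R n]_t (cameron_martin h t `^ alpha)%:E =
   (expR ((alpha ^+ 2 - alpha) / 2 * dot_tuple h h))%:E)%E.
Proof.
pose ah : Rvec R n := [tuple alpha * tnth h i | i < n].
have dE t : dot_tuple ah t = alpha * dot_tuple h t.
  rewrite /dot_tuple mulr_sumr; apply: eq_bigr => i _.
  by rewrite tnth_mktuple mulrA.
have ddE : dot_tuple ah ah = alpha ^+ 2 * dot_tuple h h.
  rewrite /dot_tuple mulr_sumr; apply: eq_bigr => i _.
  by rewrite tnth_mktuple; ring.
have cmE t : cameron_martin h t `^ alpha =
    expR ((alpha ^+ 2 - alpha) / 2 * dot_tuple h h) * cameron_martin ah t.
  rewrite /cameron_martin -expRM -expRD; congr expR.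
  by rewrite ddE dE; field.
under eq_integral do rewrite cmE EFinM.
rewrite ge0_integralZl ?integral_cameron_martin ?mule1//.
- by apply/measurable_EFinP; exact: measurable_cameron_martin.
- by move=> t _; rewrite lee_fin expR_ge0.
Qed.

(** * Null sets under shifts and affine maps *)

(** By the Cameron-Martin formula the left side is the integral of a density over the null set
    [B]. *)
Lemma std_gaussian_shift_null (R : realType) n (h : Rvec R n) (B : set (Rvec R n)) :
  measurable B -> std_gaussian R n B = 0%E ->
  std_gaussian R n (shift_tuple h @^-1` B) = 0%E.
Proof.
move=> mB B0.
have mhB : measurable (shift_tuple h @^-1` B).
  by rewrite -[_ @^-1` _]setTI; exact: measurable_shift_tuple.
pose f (t : Rvec R n) : \bar R := (\1_B t)%:E.
have mf : measurable_fun setT f by exact/measurable_EFinP.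
have f0 t : (0 <= f t)%E by rewrite lee_fin.
transitivity (\int[std_gaussian R n]_t f (shift_tuple h t))%E.
  by rewrite -[X in std_gaussian R n X]setIT -integral_indic.
rewrite std_gaussian_cameron_martin//.
transitivity (\int[std_gaussian R n]_(t in B) (cameron_martin h t)%:E)%E.
  rewrite [RHS]integral_mkcond; apply: eq_integral => t _.
  by rewrite /f patchE indicE; case: ifP => _; rewrite ?mul1e ?mul0e.
apply: null_set_integral => //.
by apply/measurable_EFinP/measurable_funTS; exact: measurable_cameron_martin.
Qed.

Lemma shift_tupleC (R : realType) n (x y : Rvec R n) :
  shift_tuple x y = shift_tuple y x.
Proof. by apply: eq_from_tnth => i; rewrite !tnth_mktuple addrC. Qed.

Lemma std_gaussian_dominates (R : realType) n :
  std_gaussian R n `<< lebesgue_vec R n.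
Proof. exact/null_dominates_tuple_measure/normal_prob_dominates. Qed.

(** The premise on shifts is the form in which [f] being affine and onto is used: every translation
    of the output comes from a translation of the input. *)
Lemma std_gaussian_affine_null (R : realType) n (f : Rvec R n -> Rvec R n)
    (A : set (Rvec R n)) :
  measurable_fun setT f ->
  (forall y, exists h, forall z, shift_tuple y (f z) = f (shift_tuple h z)) ->
  measurable A -> lebesgue_vec R n A = 0%E ->
  std_gaussian R n (f @^-1` A) = 0%E.
Proof.
move=> mf fshift mA A0.
have gA0 : std_gaussian R n A = 0%E.
  by have /null_content_dominatesP := @std_gaussian_dominates R n; apply.
have mfA : measurable (f @^-1` A) by rewrite -[_ @^-1` _]setTI; exact: mf.
have mshift : measurable_fun setT
    (fun u : Rvec R n * Rvec R n => shift_tuple u.1 (f u.2)).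
  apply/measurable_fun_tnthP => i.
  rewrite (_ : _ \o _ =
    fun u : Rvec R n * Rvec R n => (tnth (f u.2) i : R) + tnth u.1 i).
    apply: (@measurable_funD _ _ R).
      apply: (measurableT_comp (measurable_tnthR i)).
      exact: measurableT_comp.
    exact: (measurableT_comp (measurable_tnthR i)).
  by apply/funext => u /=; rewrite tnth_mktuple.
pose g (u : Rvec R n * Rvec R n) : \bar R :=
  (\1_A (shift_tuple u.1 (f u.2)))%:E.
have g0 u : (0 <= g u)%E by rewrite lee_fin.
have mg : measurable_fun setT g.
  apply/measurable_EFinP.
  by apply: (measurableT_comp _ mshift); exact: measurable_indic.
have intE (B : set (Rvec R n)) : measurable B ->
    (\int[std_gaussian R n]_z (\1_B z)%:E = std_gaussian R n B)%E.
  by move=> mB; rewrite integral_indic// setIT.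
have pre h (B : set (Rvec R n)) : measurable B ->
    measurable (shift_tuple h @^-1` B).
  by move=> mB; rewrite -[_ @^-1` _]setTI; exact: measurable_shift_tuple.
(* With the order of integration exchanged, [z] is fixed and [y] is shifted by [f z]; the
   Gaussian-null set [A] stays null under that shift. *)
have int0 : (\int[std_gaussian R n]_y \int[std_gaussian R n]_z g (y, z) = 0)%E.
  rewrite fubini_tonelli//; apply: integral0_eq => z _.
  rewrite -(std_gaussian_shift_null (f z) mA gA0) -intE; last exact: pre.
  by apply: eq_integral => y _; rewrite /g/= shift_tupleC.
have mF := @measurable_fun_fubini_tonelli_F _ _ _ _ R
    (std_gaussian R n) g mg g0.
(* The inner integral vanishes for almost every [y], and a measure of total mass 1 leaves room for
   at least one such [y]. *)
have [y y0] : exists y, (\int[std_gaussian R n]_z g (y, z) = 0)%E.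
  have := (ae_eq_integral_abs (std_gaussian R n) measurableT mF).1.
  under eq_integral do rewrite gee0_abs ?integral_ge0//.
  move=> /(_ int0) [N [mN N0 NB]]; apply: contrapT => noy.
  have NT : N = setT.
    apply/seteqP; split => // y _; apply: NB => /= /(_ I) Fy.
    by apply: noy; exists y.
  have : std_gaussian R n setT = 0%E by rewrite -NT; exact: N0.
  by rewrite std_gaussian_setT => /eqP; rewrite onee_eq0.
have [h hE] := fshift y.
have hA0 : std_gaussian R n (shift_tuple h @^-1` (f @^-1` A)) = 0%E.
  rewrite -intE; last exact: pre.
  rewrite -y0; apply: eq_integral => z _.
  by rewrite /g /= hE.
(* Shifting back by the opposite of [h] recovers the preimage of [A] under [f] itself. *)
pose h' : Rvec R n := [tuple - tnth h i | i < n].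
rewrite -(std_gaussian_shift_null h' _ hA0); last exact: pre.
congr (std_gaussian R n _); apply/seteqP; split => z /=;
  rewrite (_ : shift_tuple h (shift_tuple h' z) = z)//;
  by apply: eq_from_tnth => i; rewrite !tnth_mktuple subrK.
Qed.

(** * The perturbation map and its inverse *)

Lemma measurable_perturb (R : realType) m (rho : R) (S : 'M[R]_m) (a : Rvec R m) :
  measurable_fun setT (perturb rho S a).
Proof.
apply/measurable_fun_tnthP => j.
rewrite (_ : _ \o _ = fun z : Rvec R m => (tnth a j : R) +
    (Num.sqrt (2 * rho))^-1 * \sum_l S j l * tnth z l).
  apply: (@measurable_funD _ _ R) => //.
  apply: measurable_funM => //; apply: measurable_sum => l.
  by apply: measurable_funM => //; exact: measurable_tnthR.
apply/funext => z /=; rewrite tnth_mktuple mxE.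
by congr (_ + _ * _); apply: eq_bigr => l _; rewrite mxE.
Qed.

Definition col_tuple (R : realType) m (a : Rvec R m) : 'cV[R]_m :=
  \col_j tnth a j.

(* The noise that produces a displacement v: the inverse of
   z |-> (2 rho)^(-1/2) S z. *)
Definition whiten (R : realType) m (rho : R) (S : 'M[R]_m) (v : 'cV[R]_m) :
    Rvec R m :=
  [tuple (Num.sqrt (2 * rho) *: (invmx S *m v)) j 0 | j < m].

(** The displacement [a - b] is absorbed into the noise: applying (2 rho)^(-1/2) S to its [whiten]
    gives it back. *)
Lemma perturb_whiten (R : realType) m (rho : R) (S : 'M[R]_m) (a b z : Rvec R m) :
  0 < rho -> S \in unitmx ->
  perturb rho S a z =
  perturb rho S b (shift_tuple (whiten rho S (col_tuple a - col_tuple b)) z).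
Proof.
move=> rho0 Su; apply: eq_from_tnth => j; rewrite !tnth_mktuple.
have c0 : Num.sqrt (2 * rho) != 0 by rewrite gt_eqF// sqrtr_gt0 mulr_gt0.
rewrite -/(col_tuple z) -/(col_tuple (shift_tuple _ z)).
have -> : col_tuple (shift_tuple (whiten rho S (col_tuple a - col_tuple b)) z) =
    col_tuple z +
    Num.sqrt (2 * rho) *: (invmx S *m (col_tuple a - col_tuple b)).
  by apply/matrixP => i k; rewrite (ord1 k) !mxE !tnth_mktuple !mxE.
rewrite mulmxDr -scalemxAr mulKVmx//.
move: (S *m col_tuple z) => Sz; rewrite !mxE.
by field.
Qed.

Lemma perturb_shift (R : realType) m (rho : R) (S : 'M[R]_m) (a y z : Rvec R m) :
  shift_tuple y (perturb rho S a z) = perturb rho S (shift_tuple y a) z.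
Proof.
by apply: eq_from_tnth => j; rewrite !tnth_mktuple addrAC.
Qed.

(** Shifting the output changes only the centre [a], and [perturb_whiten] turns a change of centre
    into a shift of the noise. *)
Lemma perturb_dominates (R : realType) m (rho : R) (S : 'M[R]_m) (a : Rvec R m) A :
  0 < rho -> S \in unitmx -> measurable A -> lebesgue_vec R m A = 0%E ->
  std_gaussian R m (perturb rho S a @^-1` A) = 0%E.
Proof.
move=> rho0 Su; apply: std_gaussian_affine_null.
  exact: measurable_perturb.
move=> y; exists (whiten rho S (col_tuple (shift_tuple y a) - col_tuple a)) => z.
by rewrite perturb_shift; exact: perturb_whiten.
Qed.

(** Symmetry of [S] gives |S^-1 v|^2 = v^T (S S)^-1 v, and the scale contributes its square 2
    rho. *)
Lemma dot_whiten (R : realType) m (rho : R) (S : 'M[R]_m) (v : 'cV[R]_m) :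
  0 < rho -> S \in unitmx -> S^T = S ->
  dot_tuple (whiten rho S v) (whiten rho S v) =
  2 * rho * (v^T *m invmx (S *m S) *m v) 0 0.
Proof.
move=> rho0 Su ST.
have -> : invmx (S *m S) = invmx S *m invmx S.
  have SSu : S *m S \in unitmx by rewrite unitmx_mul Su.
  apply: (can_inj (mulKmx SSu)).
  by rewrite mulmxV// !mulmxA mulmxK// mulmxV.
have -> : v^T *m (invmx S *m invmx S) *m v = (invmx S *m v)^T *m (invmx S *m v).
  by rewrite trmx_mul trmx_inv ST !mulmxA.
rewrite mxE mulr_sumr; apply: eq_bigr => i _; rewrite !tnth_mktuple !mxE.
rewrite mulrACA -expr2 sqr_sqrtr; last by rewrite mulr_ge0// ltW.
by [].
Qed.

Lemma spd_unitmx (R : realType) m (S : 'M[R]_m) : spd S -> S \in unitmx.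
Proof.
move=> [ST Spos]; rewrite unitmxE unitfE; apply/det0P => -[v v0 vS].
have := Spos v^T; rewrite trmxK vS mul0mx mxE ltxx.
by rewrite -(inj_eq (@trmx_inj _ _ _)) trmxK trmx0 => /(_ v0).
Qed.

(** * Gram matrix, L2 distance and coordinates on the span *)

Section L2_lincomb.
Context d (T : measurableType d) (R : realType).
Variables (mu : {measure set T -> \bar R}) (m : nat).
Variable phi : 'I_m -> LfunType mu (lee1n 2).

Lemma lincombE (a : Rvec R m) x :
  (lincomb phi a : T -> R) x = \sum_j tnth a j * phi j x.
Proof.
exact: (big_morph (fun u : LfunType mu (lee1n 2) => (u : T -> R) x)).
Qed.

Lemma integrable_Lfun_mul (u v : LfunType mu (lee1n 2)) :
  mu.-integrable setT (fun x => (u x * v x)%:E).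
Proof.
by apply/Lfun1_integrable; exact: (Lfun2_mul_Lfun1 (LfunP u) (LfunP v)).
Qed.

(** The square expands into products of two square-integrable functions; these are integrable, so
    the finite sums leave the integral. *)
Lemma integral_lincomb_sqr (a : Rvec R m) :
  \int[mu]_x (lincomb phi a x ^+ 2) =
  ((col_tuple a)^T *m gram phi *m col_tuple a) 0 0.
Proof.
rewrite /Rintegral.
under eq_integral do rewrite lincombE expr2 mulr_suml -sumEFin.
have iphi i j : mu.-integrable setT
    (fun x => (tnth a i * tnth a j)%:E * (phi i x * phi j x)%:E)%E.
  by apply: integrableZl => //; exact: integrable_Lfun_mul.
have sumE i x : ((tnth a i * phi i x * \sum_j tnth a j * phi j x)%:E =
    \sum_j ((tnth a i * tnth a j)%:E * (phi i x * phi j x)%:E))%E.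
  rewrite mulr_sumr -sumEFin; apply: eq_bigr => j _.
  by rewrite -EFinM; congr EFin; ring.
under eq_integral do under eq_bigr do rewrite sumE.
rewrite integral_sum//; last first.
  by move=> i; apply: integrable_sum => // j _.
under eq_bigr do rewrite integral_sum//.
have gE i j : (\int[mu]_x ((tnth a i * tnth a j)%:E * (phi i x * phi j x)%:E) =
    (tnth a i * tnth a j * gram phi i j)%:E)%E.
  rewrite integralZl//; last exact: integrable_Lfun_mul.
  rewrite [RHS]EFinM; congr (_ * _)%E.
  rewrite mxE /Rintegral fineK//.
  exact: integrable_fin_num (integrable_Lfun_mul _ _).
under eq_bigr do under eq_bigr do rewrite gE.
under eq_bigr do rewrite sumEFin.
rewrite sumEFin /= mxE exchange_big/=; apply: eq_bigr => j _.
rewrite !mxE mulr_suml; apply: eq_bigr => i _; rewrite !mxE.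
by ring.
Qed.

Lemma L2_class_ae_eq (u v : LfunType mu (lee1n 2)) :
  L2_class u = L2_class v -> (u : T -> R) = v %[ae mu].
Proof.
move=> uv; have := L2_piE u; have := L2_piE v.
(* The bundled proof of finite norm is projected away, leaving the almost-everywhere classes. *)
have -> : L2_pi u = L2_pi v by exact: (congr1 (@LebesgueSpace.sort _ _ _ _ _ _) uv).
by apply: filterS2 => x /(_ I) vx /(_ I) ux _; rewrite -ux.
Qed.

(** [dist2] integrates representatives chosen in the two classes; they agree almost everywhere with
    [u] and [v]. *)
Lemma dist2_sqr (u v : LfunType mu (lee1n 2)) :
  dist2 (L2_class u) (L2_class v) ^+ 2 = \int[mu]_x ((u x - v x) ^+ 2).
Proof.
rewrite /dist2 sqr_sqrtr; last by apply: Rintegral_ge0 => x _; exact: sqr_ge0.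
have mL (w : {mfun_ mu, T >-> measurableTypeR R}) :
  measurable_fun setT (w : T -> R) := @measurable_funPT _ _ _ _ (repr w).
have mu' := @measurable_funPT _ _ _ _ u.
have mv' := @measurable_funPT _ _ _ _ v.
rewrite /Rintegral; congr fine; apply: ae_eq_integral => //.
- apply/measurable_EFinP; apply: measurable_funX.
  by apply: measurable_funB; exact: mL.
- apply/measurable_EFinP; apply: measurable_funX.
  by apply: measurable_funB.
have := L2_piE u; have := L2_piE v.
by apply: filterS2 => x /(_ I) /= -> /(_ I) /= -> _.
Qed.

Lemma dist2_lincomb_sqr (a b : Rvec R m) :
  dist2 (L2_class (lincomb phi a)) (L2_class (lincomb phi b)) ^+ 2 =
  ((col_tuple a - col_tuple b)^T *m gram phi *m (col_tuple a - col_tuple b)) 0 0.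
Proof.
pose c : Rvec R m := [tuple (tnth a j : R) - tnth b j | j < m].
have -> : col_tuple a - col_tuple b = col_tuple c.
  by apply/matrixP => j k; rewrite !mxE tnth_mktuple.
rewrite dist2_sqr -integral_lincomb_sqr; apply: eq_Rintegral => x _.
rewrite !lincombE -sumrB; congr (_ ^+ 2); apply: eq_bigr => j _.
by rewrite tnth_mktuple mulrBl.
Qed.

Hypothesis phi_free : lin_indep phi.

(** [coef] selects some [b] with the same class as [a]; the combination with coefficients [b - a] is
    then zero almost everywhere, and independence forces [b = a]. *)
Lemma f_K : cancel (f_ phi) (@coef _ _ _ _ _ phi).
Proof.
move=> a; rewrite /coef; case: cid => b /= ab.
apply: eq_from_tnth => j.
pose c : Rvec R m := [tuple (tnth b j : R) - tnth a j | j < m].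
have := phi_free (a := c) _ j; rewrite tnth_mktuple => cj.
apply/eqP; rewrite -subr_eq0; apply/eqP/cj.
have := L2_class_ae_eq ab; apply: filterS => x /(_ I) + _ /=.
rewrite !lincombE => /eqP; rewrite eq_sym -subr_eq0 -sumrB => /eqP abx.
rewrite -[RHS]abx.
by apply: eq_bigr => i _; rewrite tnth_mktuple mulrBl.
Qed.

Lemma coefK : cancel (@coef _ _ _ _ _ phi) (f_ phi).
Proof.
move=> u; case: u => u hu; apply: eq_exist.
by rewrite /coef/=; case: cid.
Qed.

(** By bijectivity the preimage of [B] under [coef] is the image of [B] under [f_], a generator of
    the sigma-algebra. *)
Lemma measurable_coef :
  measurable_fun [set: Uf_measurableType phi] (@coef _ _ _ _ _ phi).
Proof.
move=> _ B mB; rewrite setTI; apply: sub_sigma_algebra; exists B => //.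
apply/seteqP; split => [_ [a Ba <-]|u /= Bu]; first by rewrite /= f_K.
by exists (coef u) => //; exact: coefK.
Qed.

Lemma measurable_f_ :
  measurable_fun setT (f_ phi : Rvec R m -> Uf_measurableType phi).
Proof.
apply: measurability => //.
move=> _ [_ [B mB <-] <-]; rewrite setTI (_ : _ @^-1` _ = B)//.
apply/seteqP; split => [a [b Bb] /(can_inj f_K) <-//|a Ba /=].
by exists a.
Qed.

End L2_lincomb.

(** * Existence and transport of densities *)

(** With [e] and [g] taken as [f_] and [coef], this brings an arbitrary density on [Uf] down to
    coefficient vectors; the next lemma goes the other way. *)
Lemma has_density_pullback d d' (X : measurableType d) (Y : measurableType d')
    (R : realType) (nu : {measure set X -> \bar R}) (Q : set Y -> \bar R)
    (e : X -> Y) (g : Y -> X) (p : Y -> R) :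
  measurable_fun setT e -> measurable_fun setT g -> cancel e g ->
  has_density (pushforward nu e) Q p ->
  has_density nu (pushforward Q g) (p \o e).
Proof.
move=> me mg eK [mp p0 Qp]; split => [||A mA].
- exact: measurableT_comp.
- by move=> x; exact: p0.
have mgA : measurable (g @^-1` A) by rewrite -[_ @^-1` _]setTI; exact: mg.
rewrite /pushforward Qp// ge0_integral_pushforward//.
- rewrite -comp_preimage (_ : g \o e = id) ?preimage_id//.
  by apply/funext => x; exact: eK.
- exact/measurable_EFinP/measurable_funTS.
- by move=> y _; rewrite lee_fin.
Qed.

Lemma has_density_pushforward d d' (X : measurableType d) (Y : measurableType d')
    (R : realType) (nu : {measure set X -> \bar R}) (Q : set X -> \bar R)
    (e : X -> Y) (g : Y -> X) (p : X -> R) :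
  measurable_fun setT e -> measurable_fun setT g -> cancel e g ->
  has_density nu Q p ->
  has_density (pushforward nu e) (pushforward Q e) (p \o g).
Proof.
move=> me mg eK [mp p0 Qp]; split => [||B mB].
- exact: measurableT_comp.
- by move=> x; exact: p0.
have meB : measurable (e @^-1` B) by rewrite -[_ @^-1` _]setTI; exact: me.
have mpg : measurable_fun setT (p \o g) by exact: measurableT_comp.
rewrite /pushforward Qp// [RHS]ge0_integral_pushforward//.
- by apply: eq_integral => x _ /=; rewrite eK.
- exact/measurable_EFinP/measurable_funTS.
- by move=> y _; rewrite lee_fin; exact: p0.
Qed.

(** [CGP] speaks of bare set functions, while the Radon-Nikodym arguments need a bundled finite
    measure. *)
Lemma image_finite_measure d d' (T : measurableType d) (V : measurableType d')
    (R : realType) (P : probability T R) (X : T -> V) :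
  measurable_fun setT X ->
  exists Q : {finite_measure set V -> \bar R}, (Q : set V -> \bar R) = pushforward P X.
Proof.
move=> mX.
pose X' : {RV P >-> V} := HB.pack_for {mfun T >-> V} X
  (isMeasurableFun.Build _ _ T V X mX).
by exists (distribution P X').
Qed.

(** The Radon-Nikodym derivative is finite everywhere, so [fine] loses nothing. *)
Lemma null_dominates_density d (T : measurableType d) (R : realType)
    (nu : {sigma_finite_measure set T -> \bar R})
    (Q : {finite_measure set T -> \bar R}) :
  Q `<< nu -> exists p, has_density nu Q p.
Proof.
move=> Qnu; exists (fine \o Radon_Nikodym_SigmaFinite.f Q nu); split.
- apply: measurableT_comp => //.
  exact: measurable_int (Radon_Nikodym_SigmaFinite.f_integrable Qnu).
- by move=> x /=; rewrite fine_ge0// Radon_Nikodym_SigmaFinite.f_ge0.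
- move=> A mA; rewrite (Radon_Nikodym_SigmaFinite.f_integral Qnu)//.
  apply: eq_integral => x _; rewrite fineK//.
  exact: Radon_Nikodym_SigmaFinite.f_fin_num.
Qed.

(** * Renyi divergence between two perturbed vectors *)

Section perturb_law.
Variables (R : realType) (m : nat) (rho : R) (S : 'M[R]_m).
Hypotheses (rho0 : 0 < rho) (Su : S \in unitmx).

(** The noise is recovered from the output, so a density expressed in the noise becomes a function
    of the output. *)
Lemma whitenK (b z : Rvec R m) :
  whiten rho S (col_tuple (perturb rho S b z) - col_tuple b) = z.
Proof.
have c0 : Num.sqrt (2 * rho) != 0 by rewrite gt_eqF// sqrtr_gt0 mulr_gt0.
have -> : col_tuple (perturb rho S b z) - col_tuple b =
    (Num.sqrt (2 * rho))^-1 *: (S *m col_tuple z).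
  apply/matrixP => i k; rewrite (ord1 k) !mxE tnth_mktuple -/(col_tuple z).
  by rewrite addrC addKr mxE.
apply: eq_from_tnth => j; rewrite tnth_mktuple -scalemxAr mulKmx//.
by rewrite scalerA divff// scale1r mxE.
Qed.

Lemma measurable_whiten (b : Rvec R m) :
  measurable_fun setT (fun y => whiten rho S (col_tuple y - col_tuple b)).
Proof.
apply/measurable_fun_tnthP => j.
rewrite (_ : _ \o _ = fun y : Rvec R m => Num.sqrt (2 * rho) *
    \sum_l invmx S j l * (tnth y l - tnth b l)).
  apply: measurable_funM => //; apply: measurable_sum => l.
  apply: measurable_funM => //; apply: measurable_funB => //.
  exact: measurable_tnthR.
apply/funext => y /=; rewrite tnth_mktuple !mxE.
by congr (_ * _); apply: eq_bigr => l _; rewrite !mxE.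
Qed.

(** Restricted to measurable sets, where the law of the noise is prescribed. *)
Definition perturb_law (b : Rvec R m) (Q : set (Rvec R m) -> \bar R) :=
  forall A, measurable A -> Q A = std_gaussian R m (perturb rho S b @^-1` A).

Lemma ge0_integral_perturb_law (b : Rvec R m) (Q : {measure set (Rvec R m) -> \bar R})
    (g : Rvec R m -> \bar R) :
  perturb_law b Q -> measurable_fun setT g -> (forall y, 0 <= g y)%E ->
  (\int[Q]_y g y = \int[std_gaussian R m]_z g (perturb rho S b z))%E.
Proof.
move=> Qb mg g0.
pose mu := measure_function_pushforward__canonical__measure_function_Measure
  (std_gaussian R m) (measurable_perturb rho S b).
transitivity (\int[mu]_y g y)%E.
  by apply: eq_measure_integral => A mA _; exact: Qb.
by rewrite ge0_integral_pushforward//; exact: measurable_perturb.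
Qed.

(** The divergence is computed exactly, so the privacy bound will hold with equality. *)
Lemma renyi_perturb_law (a b : Rvec R m)
    (Qa Qb : {finite_measure set (Rvec R m) -> \bar R}) (p q : Rvec R m -> R)
    (alpha : R) :
  S^T = S -> 1 < alpha -> perturb_law a Qa -> perturb_law b Qb ->
  has_density (lebesgue_vec R m) Qa p -> has_density (lebesgue_vec R m) Qb q ->
  renyi_divergence (lebesgue_vec R m) alpha p q =
  (alpha * rho * ((col_tuple a - col_tuple b)^T *m invmx (S *m S) *m
                  (col_tuple a - col_tuple b)) 0 0)%:E.
Proof.
move=> ST alpha1 Qap Qbq dp dq.
pose h := whiten rho S (col_tuple a - col_tuple b).
(* The density of [Qa] relative to [Qb]: the output [y] is converted to the noise that produces it
   from [b]. *)
pose r y := cameron_martin h (whiten rho S (col_tuple y - col_tuple b)).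
have mr : measurable_fun setT r.
  apply: measurableT_comp; first exact: measurable_cameron_martin.
  exact: measurable_whiten.
have r0 y : 0 <= r y by exact: expR_ge0.
have rE z : r (perturb rho S b z) = cameron_martin h z by rewrite /r whitenK.
(* Both sides are pulled back to the noise; [a] is exchanged for [b] by a shift, which the
   Cameron-Martin formula turns into the weight [r]. *)
have QaE A : measurable A -> Qa A = (\int[Qb]_(y in A) (r y)%:E)%E.
  move=> mA; rewrite integral_mkcond.
  pose f (y : Rvec R m) : \bar R := (\1_A y)%:E.
  have mf : measurable_fun setT f by exact/measurable_EFinP.
  have f0 y : (0 <= f y)%E by rewrite lee_fin.
  have mfr : measurable_fun setT (fun y => f y * (r y)%:E)%E.
    by apply: emeasurable_funM => //; exact/measurable_EFinP.
  transitivity (\int[Qb]_y (f y * (r y)%:E))%E; last first.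
    apply: eq_integral => y _; rewrite /f patchE indicE.
    by case: ifP => _; rewrite ?mul1e ?mul0e.
  rewrite (ge0_integral_perturb_law Qbq)//; last first.
    by move=> y; rewrite mule_ge0// lee_fin.
  transitivity (\int[Qa]_y f y)%E; first by rewrite integral_indic// setIT.
  rewrite (ge0_integral_perturb_law Qap)//.
  under eq_integral do rewrite (perturb_whiten a b _ rho0 Su).
  under [RHS]eq_integral do rewrite rE.
  rewrite (std_gaussian_cameron_martin h (f := fun z => f (perturb rho S b z)))//.
  by apply: measurableT_comp mf _; exact: measurable_perturb.
have alpha0 : alpha != 0 by rewrite gt_eqF// (lt_trans ltr01).
rewrite /renyi_divergence (integral_renyi_integrand alpha0 mr r0 QaE dp dq).
rewrite (ge0_integral_perturb_law Qbq); last 2 first.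
- apply/measurable_EFinP; exact: (measurableT_comp (measurable_powR _)).
- by move=> y; rewrite lee_fin powR_ge0.
under eq_integral do rewrite rE.
rewrite integral_cameron_martin_powR lne_EFin ?expR_gt0// expRK dot_whiten//.
rewrite -EFinM; congr EFin.
(* The factor alpha - 1 of (alpha^2 - alpha) / 2 cancels the normalisation, and 2 rho cancels the
   remaining half. *)
by field; rewrite subr_eq0 gt_eqF.
Qed.

End perturb_law.

Theorem theorem3p3 (R : realType) (d m : nat)
    (I : 'I_d -> set R) (mI : forall i, lebesgue_measurable (I i))
    (phi : 'I_m -> LfunType (lebesgue_on mI) (lee1n 2)) (rho : R)
    (Sh : 'M[R]_m)
    (dO : measure_display) (Omega : measurableType dO) (P : probability Omega R)
    (Z : {RV P >-> Rvec R m}) :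
  0 < rho ->
  lin_indep phi ->
  is_spd_sqrt (invmx (gram phi)) Sh ->
  (forall A, measurable A -> distribution P Z A = std_gaussian R m A) ->
  CGP (fun u v : Uf phi => dist2 (sval u) (sval v)) (Uf_lebesgue phi) P
    (gaussian_mechanism rho Sh Z) rho.
Proof.
move=> rho0 phi_free [Sspd SS] ZE.
have Su := spd_unitmx Sspd.
have mf := measurable_f_ phi_free; have mc := measurable_coef phi_free.
have mpZ a : measurable_fun setT (fun w => perturb rho Sh a (Z w)).
  exact: (measurableT_comp (measurable_perturb rho Sh a)).
have mM u : measurable_fun setT (gaussian_mechanism (phi := phi) rho Sh Z u).
  exact: (measurableT_comp mf (mpZ _)).
have lawP a : perturb_law rho Sh a
    (pushforward P (fun w => perturb rho Sh a (Z w))).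
  move=> A mA; rewrite -ZE//.
  by rewrite -[_ @^-1` _]setTI; exact: measurable_perturb.
split => //.
  move=> u; have [Q QE] := image_finite_measure P (mpZ (coef u)).
  (* A density is found on coefficient vectors first and then carried to [Uf] by [coef]. *)
  have [|p pQ] := @null_dominates_density _ _ _ (lebesgue_vec R m) Q.
    apply/null_content_dominatesP => A mA A0.
    by rewrite QE lawP//; exact: perturb_dominates.
  exists (p \o @coef _ _ _ _ _ phi).
  have := has_density_pushforward mf mc (f_K phi_free) pQ.
  by rewrite QE.
move=> u v p q alpha alpha1 dp dq.
(* Any version of a density on [Uf], read through [f_], is a density of the perturbed coefficients,
   since [coef] undoes [f_]. *)
have pull w r : has_density (Uf_lebesgue phi)
    (pushforward P (gaussian_mechanism rho Sh Z w)) r ->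
    has_density (lebesgue_vec R m)
      (pushforward P (fun x => perturb rho Sh (coef w) (Z x))) (r \o f_ phi).
  move=> /(has_density_pullback mf mc (f_K phi_free)).
  rewrite (_ : pushforward (pushforward _ _) _ =
    pushforward P (fun x => perturb rho Sh (coef w) (Z x)))//.
  apply/funext => A; rewrite /pushforward -comp_preimage; congr (P _).
  by apply/seteqP; split => x /=; rewrite /gaussian_mechanism f_K.
have [Qu QuE] := image_finite_measure P (mpZ (coef u)).
have [Qv QvE] := image_finite_measure P (mpZ (coef v)).
(* The reference measure on [Uf] is the image of Lebesgue measure under [f_], so the divergence is
   unchanged. *)
have -> : renyi_divergence (Uf_lebesgue phi) alpha p q =
    renyi_divergence (lebesgue_vec R m) alpha (p \o f_ phi) (q \o f_ phi).
  have [[mp _ _] [mq _ _]] := (dp, dq).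
  rewrite /renyi_divergence; congr (_ * lne _)%E.
  rewrite [LHS]ge0_integral_pushforward//.
  - exact: measurable_renyi_integrand.
  - by move=> y _; exact: renyi_integrand_ge0.
rewrite (@renyi_perturb_law _ _ rho Sh rho0 Su (coef u) (coef v) Qu Qv)//.
(* [Sh *m Sh] is the inverse Gram matrix, so the quadratic form is that of [gram phi], the squared
   L2 distance. *)
- rewrite SS invmxK -dist2_lincomb_sqr.
  have sE (w : Uf phi) : sval w = L2_class (lincomb phi (coef w)).
    by rewrite -[in LHS](coefK w).
  by rewrite -!sE.
- by case: Sspd.
- by rewrite QuE.
- by rewrite QvE.
- by rewrite QuE; exact: pull.
- by rewrite QvE; exact: pull.
Qed.
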